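(* Let $\beta\in\mathbb{C}$ with $|\beta|=1$, let $m\in\mathrm{Hol}(\mathbb{D})$, $m\not\equiv0$, and let $T:\mathrm{Hol}(\mathbb{D})\to\mathrm{Hol}(\mathbb{D})$ be given by $(Tf)(z)=m(z)f(\beta z)$. Then $\sigma(T)=\beta\sigma(T)\cup\{m(0)\}$.
   Context: $\mathbb{D}$ is the open unit disc, $\mathrm{Hol}(\mathbb{D})$ the Fréchet space of holomorphic functions on $\mathbb{D}$. $\sigma(T)$ is the set of $\lambda\in\mathbb{C}$ such that $\lambda\mathrm{Id}-T$ is not bijective on $\mathrm{Hol}(\mathbb{D})$, and $\beta\sigma(T)=\{\beta\lambda:\lambda\in\sigma(T)\}$. *)

(* Defs.v *)
From HB Require Import structures.
From mathcomp Require Import all_boot all_order all_algebra.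
From mathcomp Require Import all_classical all_reals all_analysis.
From mathcomp Require Import complex.
Set Implicit Arguments. Unset Strict Implicit. Unset Printing Implicit Defensive.
Import Order.TTheory GRing.Theory Num.Theory.
Import numFieldNormedType.Exports.
Local Open Scope ring_scope.
Local Open Scope classical_set_scope.

(* Complex numbers over a real type: Cplx R := R[i] = complex R, viewed as a
   numClosedFieldType, hence (numFieldNormedType) a normed module over
   itself with the modulus as norm. *)
Definition Cplx (R : realType) : numClosedFieldType := R[i].

(* f : C -> C is holomorphic on the open unit disc: complex-differentiable
   at every point of the disc (values outside the disc are irrelevant). *)
Definition holo_disc (R : realType) (f : Cplx R -> Cplx R) : Prop :=
  forall z : Cplx R, `|z| < 1 -> derivable f z 1.

Definition wcomp (R : realType) (m : Cplx R -> Cplx R) (beta : Cplx R)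
  (f : Cplx R -> Cplx R) (z : Cplx R) : Cplx R := m z * f (beta * z).

Definition shifted_op (R : realType) (m : Cplx R -> Cplx R) (beta lam : Cplx R)
  (f : Cplx R -> Cplx R) (z : Cplx R) : Cplx R :=
  lam * f z - wcomp m beta f z.

(* An operator S : Hol(D) -> Hol(D) is bijective on Hol(D).  Elements of
   Hol(D) are holomorphic functions on D, identified when they agree on D. *)
Definition bijective_on_Hol (R : realType)
  (S : (Cplx R -> Cplx R) -> (Cplx R -> Cplx R)) : Prop :=
  (forall f g, holo_disc f -> holo_disc g ->
     (forall z : Cplx R, `|z| < 1 -> S f z = S g z) ->
     (forall z : Cplx R, `|z| < 1 -> f z = g z)) /\
  (forall g, holo_disc g ->
     exists f, holo_disc f /\
       (forall z : Cplx R, `|z| < 1 -> S f z = g z)).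

Definition spectrum_wcomp (R : realType) (m : Cplx R -> Cplx R) (beta : Cplx R)
  : set (Cplx R) :=
  [set lam | ~ bijective_on_Hol (shifted_op m beta lam)].

(* Main.v *)
(** The only analytic input is that [(g z - g 0) / z] extends holomorphically over 0
    when [g] is holomorphic.  Then [f = z h] identifies the functions vanishing at 0
    with [Hol(D)], and [T (z h) = beta z T h]; so [beta lam - T] on that hyperplane
    is conjugate, up to the factor [beta], to [lam - T] on [Hol(D)], while on the
    one-dimensional quotient it is multiplication by [beta lam - m 0].  Hence for
    [beta lam <> m 0] the operators [lam - T] and [beta lam - T] are bijective
    together, and [m 0 - T] is never onto.

    Holomorphy only means complex differentiability here.  Goursat's bisection
    argument, run on left Riemann sums of dyadic subdivisions instead of integrals,
    shows that these sums around a square tend to 0.  Applied to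
    [(f z - f w) / (z - w)] it bounds [f w] by twice the supremum of [f] on an
    annulus around [w]; the constant 2 disappears by taking powers of [f].  The
    resulting maximum principle, applied to differences of divided differences,
    makes [(h v - h 0) / v] Cauchy as [v] tends to 0, where [h z = (g z - g 0) / z]. *)

Require Import Defs.
From HB Require Import structures.
From mathcomp Require Import all_boot all_order all_algebra.
From mathcomp Require Import all_classical all_reals all_analysis.
From mathcomp Require Import complex.
From mathcomp Require Import ring lra.
Import Order.TTheory GRing.Theory Num.Theory.
Import numFieldNormedType.Exports.
Local Open Scope ring_scope.
Local Open Scope classical_set_scope.

(** * Complex modulus and limits *)

Section Modulus.
Context {R : realType}.
Implicit Types (z w : Cplx R) (f : Cplx R -> Cplx R).

(** The norm of [Cplx R] takes its values in [Cplx R]; a modulus with values in [R] makes estimates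
    accessible to [lra]. *)
Definition cmod z : R := ComplexField.Normc.normc (z : R[i]).
Definition ofR (x : R) : Cplx R := x%:C%C.
Definition ci : Cplx R := 'i%C.

Lemma norm_cmod z : `|z| = ofR (cmod z).
Proof. by case: z. Qed.

Lemma ofR_lt (x y : R) : (ofR x < ofR y) = (x < y).
Proof. exact: ltcR. Qed.

Lemma ofR_le (x y : R) : (ofR x <= ofR y) = (x <= y).
Proof. exact: lecR. Qed.

Lemma ofRD (x y : R) : ofR (x + y) = ofR x + ofR y.
Proof. exact: rmorphD. Qed.

Lemma ofRB (x y : R) : ofR (x - y) = ofR x - ofR y.
Proof. exact: rmorphB. Qed.

Lemma ofRM (x y : R) : ofR (x * y) = ofR x * ofR y.
Proof. exact: rmorphM. Qed.

Lemma ofRV (x : R) : ofR x^-1 = (ofR x)^-1.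
Proof. exact: fmorphV. Qed.

Lemma ofRX (x : R) n : ofR (x ^+ n) = ofR x ^+ n.
Proof. exact: rmorphXn. Qed.

Lemma ofR_nat n : ofR n%:R = n%:R.
Proof. exact: rmorph_nat. Qed.

Lemma ofR0 : ofR 0 = 0. Proof. by []. Qed.

Lemma ofR1 : ofR 1 = 1. Proof. by []. Qed.

Lemma ofR_eq0 x : (ofR x == 0) = (x == 0).
Proof. exact: fmorph_eq0. Qed.

Lemma ci2 : ci * ci = -1.
Proof. by rewrite -expr2; exact: sqr_i. Qed.

Lemma ci_neq0 : ci != 0.
Proof. by apply/eqP => h; have /eqP := ci2; rewrite h mul0r eq_sym oppr_eq0 oner_eq0. Qed.

Lemma ofR_gt0P (e : Cplx R) : 0 < e -> exists2 x : R, 0 < x & e = ofR x.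
Proof.
move=> e0; exists (cmod e); first by rewrite -ofR_lt ofR0 -norm_cmod normr_gt0 gt_eqF.
by rewrite -norm_cmod gtr0_norm.
Qed.

Lemma cmod_ge0 z : 0 <= cmod z.
Proof. by rewrite -ofR_le -norm_cmod ofR0. Qed.

Lemma cmod_eq0 z : (cmod z == 0) = (z == 0).
Proof. by rewrite -ofR_eq0 -norm_cmod normr_eq0. Qed.

Lemma cmod_gt0 z : (0 < cmod z) = (z != 0).
Proof. by rewrite lt_neqAle cmod_ge0 andbT eq_sym cmod_eq0. Qed.

Lemma cmod0 : cmod 0 = 0.
Proof. by apply/eqP; rewrite cmod_eq0. Qed.

Lemma cmod1 : cmod 1 = 1.
Proof. exact: ComplexField.Normc.normc1. Qed.

Lemma cmodD z w : cmod (z + w) <= cmod z + cmod w.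
Proof. exact: le_normcD. Qed.

Lemma cmodN z : cmod (- z) = cmod z.
Proof. exact: normcN. Qed.

Lemma cmodB z w : cmod (z - w) <= cmod z + cmod w.
Proof. by rewrite -(cmodN w) cmodD. Qed.

Lemma cmod_distC z w : cmod (z - w) = cmod (w - z).
Proof. by rewrite -cmodN opprB. Qed.

Lemma cmod_triangle z1 z2 z3 : cmod (z1 - z3) <= cmod (z1 - z2) + cmod (z2 - z3).
Proof. by rewrite (_ : z1 - z3 = (z1 - z2) + (z2 - z3)) ?cmodD //; ring. Qed.

Lemma cmodM z w : cmod (z * w) = cmod z * cmod w.
Proof. exact: ComplexField.Normc.normcM. Qed.

Lemma cmodX z n : cmod (z ^+ n) = cmod z ^+ n.
Proof. by elim: n => [|n IH]; rewrite ?expr0 ?cmod1 // !exprS cmodM IH. Qed.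

Lemma cmodV z : cmod z^-1 = (cmod z)^-1.
Proof. exact: ComplexField.Normc.normcV. Qed.

Lemma cmod_ofR (x : R) : cmod (ofR x) = `|x|.
Proof. by rewrite /cmod /= expr0n addr0 sqrtr_sqr. Qed.

Lemma cmod_ci : cmod ci = 1.
Proof. by rewrite /cmod /= expr0n add0r expr1n sqrtr1. Qed.

Lemma cmod_sum (I : Type) (r : seq I) (P : pred I) (F : I -> Cplx R) :
  cmod (\sum_(i <- r | P i) F i) <= \sum_(i <- r | P i) cmod (F i).
Proof.
elim/big_ind2: _ => [|a x b y ax bx|//]; first by rewrite cmod0.
by rewrite (le_trans (cmodD _ _)) // lerD.
Qed.

Lemma complex_split z : exists x y : R, z = ofR x + ofR y * ci.
Proof. by exists (complex.Re z), (complex.Im z); rewrite mulrC; exact: complexE. Qed.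

Lemma cmod_sqr (x y : R) : cmod (ofR x + ofR y * ci) ^+ 2 = x ^+ 2 + y ^+ 2.
Proof.
rewrite /cmod /= !(mulr0, mul0r, subr0, addr0, add0r, mulr1).
by rewrite sqr_sqrtr // addr_ge0 ?sqr_ge0.
Qed.

Lemma cmod_geRe (x y : R) : `|x| <= cmod (ofR x + ofR y * ci).
Proof.
rewrite -(@ler_pXn2r _ 2) ?nnegrE ?cmod_ge0 // cmod_sqr real_normK ?num_real //.
by rewrite lerDl sqr_ge0.
Qed.

Lemma cmod_geIm (x y : R) : `|y| <= cmod (ofR x + ofR y * ci).
Proof.
rewrite -(@ler_pXn2r _ 2) ?nnegrE ?cmod_ge0 // cmod_sqr real_normK ?num_real //.
by rewrite lerDr sqr_ge0.
Qed.

(** * Limits, continuity and derivatives in real epsilon-delta form *)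

Lemma near_cmod z (P : Cplx R -> Prop) :
  (\forall w \near z, P w) <->
  exists2 d : R, 0 < d & forall w, cmod (w - z) < d -> P w.
Proof.
split=> [/nbhs_normP[e /ofR_gt0P[x x0 ->] eP]|[d d0 dP]].
  by exists x => // w wz; apply: eP => /=; rewrite norm_cmod ofR_lt cmod_distC.
apply/nbhs_normP; exists (ofR d); first by rewrite /= -ofR0 ofR_lt.
by move=> w /=; rewrite norm_cmod ofR_lt cmod_distC; exact: dP.
Qed.

Lemma dnbhs_cmod z (P : Cplx R -> Prop) :
  (\forall w \near z^', P w) <->
  exists2 d : R, 0 < d & forall w, cmod (w - z) < d -> w != z -> P w.
Proof.
by have := @near_cmod z (fun w => w != z -> P w).
Qed.

Lemma cvg_cmod (F : set_system (Cplx R)) {FF : Filter F} f (l : Cplx R) :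
  f x @[x --> F] --> l <->
  forall e : R, 0 < e -> \forall x \near F, cmod (f x - l) <= e.
Proof.
split=> [/cvgrPdist_le fl e e0|fl].
  have : 0 < ofR e by rewrite -ofR0 ofR_lt.
  by move=> /fl; apply: filterS => x; rewrite norm_cmod ofR_le cmod_distC.
apply/cvgrPdist_le => _ /ofR_gt0P[e e0 ->].
by apply: filterS (fl _ e0) => x; rewrite norm_cmod ofR_le cmod_distC.
Qed.

Lemma continuous_cmod f z : {for z, continuous f} <->
  forall e : R, 0 < e -> exists2 d : R, 0 < d &
    forall w, cmod (w - z) < d -> cmod (f w - f z) <= e.
Proof.
split=> [fz e e0|fz].
  by apply/near_cmod; exact: (cvg_cmod (nbhs z) f (f z)).1.
by apply/(cvg_cmod (nbhs z) f (f z)) => e /fz ?; apply/near_cmod.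
Qed.

(** The value at [w = z] is the one that makes the quotient continuous there when [f] is
    differentiable at [z]. *)
Definition diffquo f z w : Cplx R :=
  if w == z then 'D_1 f z else (f w - f z) / (w - z).

Lemma derivable_diffquo f z :
  derivable f z 1 <-> exists l, forall e : R, 0 < e -> exists2 d : R, 0 < d &
    forall w, cmod (w - z) < d -> w != z -> cmod ((f w - f z) / (w - z) - l) <= e.
Proof.
have E h : h^-1 *: ((f \o shift z) (h *: 1) - f z) = (f (h + z) - f z) / (h + z - z).
  by rewrite /= addrK /GRing.scale /= mulr1 mulrC.
split=> [fz|[l fl]].
  exists ('D_1 f z) => e e0; move/(cvg_cmod 0^') : fz => /(_ _ e0) /dnbhs_cmod[d d0 dP].
  exists d => // w wz w_neq; have := dP (w - z).
  by rewrite E subr0 subr_eq0 subrK; exact.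
apply/cvg_ex; exists l; apply/(cvg_cmod 0^') => e /fl[d d0 dP].
apply/dnbhs_cmod; exists d => // h; rewrite subr0 => hd h0.
by rewrite E; apply: dP; rewrite ?addrK // -subr_eq0 addrK.
Qed.

Lemma diffquo_cvg f z : derivable f z 1 -> {for z, continuous (diffquo f z)}.
Proof.
move=> fz; apply/continuous_cmod => e e0.
move/(cvg_cmod 0^') : fz => /(_ _ e0) /dnbhs_cmod[d d0 dP].
exists d => // w wz; rewrite /diffquo eqxx; case: eqP => [|/eqP] w_neq.
  by rewrite subrr cmod0 ltW.
have := dP (w - z); rewrite subr0 subr_eq0 => /(_ wz w_neq).
by rewrite /= /GRing.scale /= mulr1 subrK mulrC.
Qed.

Lemma derivable_continuous f z : derivable f z 1 -> {for z, continuous f}.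
Proof. by move=> /derivable1_diffP/differentiable_continuous. Qed.

(** * Completeness of the plane, by coordinates *)

Lemma real_cauchy (u : nat -> R) :
  (forall e, 0 < e -> exists N, forall m n, (N <= m)%N -> (N <= n)%N -> `|u m - u n| <= e) ->
  exists l, forall e, 0 < e -> exists N, forall n, (N <= n)%N -> `|u n - l| <= e.
Proof.
move=> uC; have /cauchy_cvgP /cvg_ex[/= l ul] : cauchy (u @ \oo).
  apply: cauchy_exP => e e0; have [|N NP] := uC (e / 2); first by rewrite divr_gt0.
  exists (u N); exists N => // n /= Nn; rewrite /ball /=.
  by rewrite (le_lt_trans (NP N n _ _)) //; lra.
exists l => e e0; move/cvgrPdist_le : ul => /(_ e e0)[N _ NP].
by exists N => n Nn; rewrite distrC; exact: NP.
Qed.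

Lemma complex_cauchy (u : nat -> Cplx R) :
  (forall e : R, 0 < e -> exists N, forall m n,
     (N <= m)%N -> (N <= n)%N -> cmod (u m - u n) <= e) ->
  exists l, forall e : R, 0 < e -> exists N, forall n, (N <= n)%N -> cmod (u n - l) <= e.
Proof.
move=> uC; have [x xP] := choice (fun n => complex_split (u n)).
have [y yP] := choice xP.
have uB m n : u m - u n = ofR (x m - x n) + ofR (y m - y n) * ci.
  by rewrite !yP !ofRB; ring.
have [a aP] : exists l, forall e, 0 < e -> exists N, forall n, (N <= n)%N -> `|x n - l| <= e.
  apply: real_cauchy => e /uC[N NP]; exists N => m n Nm Nn.
  by rewrite (le_trans _ (NP m n Nm Nn)) // uB cmod_geRe.
have [b bP] : exists l, forall e, 0 < e -> exists N, forall n, (N <= n)%N -> `|y n - l| <= e.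
  apply: real_cauchy => e /uC[N NP]; exists N => m n Nm Nn.
  by rewrite (le_trans _ (NP m n Nm Nn)) // uB cmod_geIm.
exists (ofR a + ofR b * ci) => e e0.
have e20 : 0 < e / 2 by rewrite divr_gt0.
have [N1 N1P] := aP _ e20; have [N2 N2P] := bP _ e20.
exists (maxn N1 N2) => n; rewrite geq_max => /andP[/N1P h1 /N2P h2].
have -> : u n - (ofR a + ofR b * ci) = ofR (x n - a) + ofR (y n - b) * ci.
  by rewrite yP !ofRB; ring.
rewrite (le_trans (cmodD _ _)) // cmodM cmod_ci !cmod_ofR; lra.
Qed.

End Modulus.

(** * Bisection of squares *)

Section Bisection.
Context {R : realType}.
Implicit Types (z w c u : Cplx R) (x y e : R).

Lemma div_pow2_small x e : 0 < e -> exists N, forall n, (N <= n)%N -> x / 2 ^+ n < e.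
Proof.
move=> e0; pose N := Num.bound (`|x| / e); exists N => n Nn.
rewrite ltr_pdivrMr ?exprn_gt0 // mulrC -ltr_pdivrMr //.
have xe : x / e <= `|x| / e by rewrite ler_pM2r ?invr_gt0 // ler_norm.
apply: (le_lt_trans xe); apply: (lt_le_trans (archi_boundP _)).
  by rewrite divr_ge0 // ltW.
rewrite -natrX ler_nat (leq_trans Nn) //; apply: ltnW; exact: ltn_expl.
Qed.

(** A rational substitute for the square root of 2, the ratio of circumradius to half-side in a
    square. *)
Lemma cmod_1Dci : cmod (1 + ci : Cplx R) <= 3 / 2.
Proof.
rewrite -(@ler_pXn2r _ 2) ?nnegrE ?cmod_ge0 ?divr_ge0 //.
have -> : 1 + ci = ofR 1 + ofR 1 * ci :> Cplx R by rewrite ofR1 mul1r.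
by rewrite cmod_sqr !expr2; lra.
Qed.

Lemma cmod_1Bci : cmod (1 - ci : Cplx R) <= 3 / 2.
Proof.
have -> : 1 - ci = - ci * (1 + ci) :> Cplx R by rewrite mulrDr !mulNr ci2; ring.
by rewrite cmodM cmodN cmod_ci mul1r cmod_1Dci.
Qed.

Lemma cmod_half z : cmod (z / 2) = cmod z / 2.
Proof. by rewrite cmodM cmodV -(ofR_nat 2) cmod_ofR ger0_norm. Qed.

Context (P : Cplx R -> Cplx R -> Prop).
(** The four centres are those of the quarters of a square with half-diagonals [(1 + ci) * u] and
    [(1 - ci) * u]. *)
Context (P_subdivision : forall c u,
  P (c + (1 + ci) * u / 2) (u / 2) -> P (c + (1 - ci) * u / 2) (u / 2) ->
  P (c - (1 + ci) * u / 2) (u / 2) -> P (c - (1 - ci) * u / 2) (u / 2) -> P c u).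

Lemma subsquare_not c u : ~ P c u ->
  exists2 c', cmod (c' - c) <= 3 / 4 * cmod u & ~ P c' (u / 2).
Proof.
move=> nP; apply: contrapT => nex.
have sub v : cmod v <= 3 / 2 -> P (c + v * u / 2) (u / 2).
  move=> v32; apply: contrapT => nPv; apply: nex; exists (c + v * u / 2) => //.
  rewrite (_ : c + _ - c = v * u / 2); last by ring.
  rewrite cmod_half cmodM; have := ler_wpM2r (cmod_ge0 u) v32; lra.
apply: nP; apply: P_subdivision.
- exact/sub/cmod_1Dci.
- exact/sub/cmod_1Bci.
- by rewrite -!mulNr; apply: sub; rewrite cmodN cmod_1Dci.
- by rewrite -!mulNr; apply: sub; rewrite cmodN cmod_1Bci.
Qed.

(* A Cousin-type covering lemma: [P c u] is read as a property of the square
   with centre [c] and half-side vector [u], and only its circumscribed disc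
   matters. *)
Lemma square_bisection c u :
  (forall z, cmod (z - c) <= 3 / 2 * cmod u -> exists2 d : R, 0 < d &
    forall c' u', cmod (z - c') <= 3 / 2 * cmod u' -> cmod u' < d -> P c' u') ->
  P c u.
Proof.
move=> locP; apply: contrapT => nP.
have /choice[nxt nxtP] : forall p : Cplx R * Cplx R, exists c', ~ P p.1 p.2 ->
    cmod (c' - p.1) <= 3 / 4 * cmod p.2 /\ ~ P c' (p.2 / 2).
  move=> [a v] /=; have [Pav|/subsquare_not[c' ? ?]] := pselect (P a v).
    by exists a.
  by exists c'.
pose s n := iter n (fun p : Cplx R * Cplx R => (nxt p, p.2 / 2)) (c, u).
have sS n : s n.+1 = (nxt (s n), (s n).2 / 2) by [].
have s2 n : cmod (s n).2 = cmod u / 2 ^+ n.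
  elim: n => [|n IH]; first by rewrite expr0 divr1.
  by rewrite sS /= cmod_half IH exprS invfM; ring.
have nPs n : ~ P (s n).1 (s n).2.
  by elim: n => // n IH; rewrite sS /=; exact: (nxtP _ IH).2.
(* Telescoped form of the geometric sum of the displacements [3 / 4 * (cmod u / 2 ^+ j)]. *)
have dist n k : cmod ((s (n + k)%N).1 - (s n).1) <=
    3 / 2 * (cmod u / 2 ^+ n) - 3 / 2 * (cmod u / 2 ^+ (n + k)).
  elim: k => [|k IH]; first by rewrite addn0 !subrr cmod0.
  apply: (le_trans (cmod_triangle _ (s (n + k)%N).1 _)).
  have := (nxtP _ (nPs (n + k)%N)).1; rewrite s2 addnS sS /=.
  rewrite exprS invfM; lra.
have dist' n m : (n <= m)%N -> cmod ((s m).1 - (s n).1) <= 3 / 2 * (cmod u / 2 ^+ n).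
  move=> /subnKC <-; apply: (le_trans (dist _ _)).
  have : 0 <= cmod u / 2 ^+ (n + (m - n)) by rewrite divr_ge0 ?cmod_ge0 ?exprn_ge0.
  lra.
have [z zP] : exists z, forall e, 0 < e ->
    exists N, forall n, (N <= n)%N -> cmod ((s n).1 - z) <= e.
  apply: complex_cauchy => e e0.
  have [N NP] := div_pow2_small (3 * cmod u) e e0.
  exists N => m n Nm Nn; apply: (le_trans (cmod_triangle _ (s N).1 _)).
  rewrite (cmod_distC (s N).1); have := NP _ (leqnn N).
  by have := dist' _ _ Nm; have := dist' _ _ Nn; lra.
(* The tail of that sum is [3 / 2] times the current half-side. So [z] lies in every circumscribed
   disc, and [locP] at [z] contradicts [nPs] for a late square. *)
have zs n : cmod (z - (s n).1) <= 3 / 2 * cmod (s n).2.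
  rewrite s2; apply/ler_addgt0Pr => e /zP[N NP].
  have := NP _ (leq_maxr n N); have := dist' _ _ (leq_maxl n N).
  have := cmod_triangle z (s (maxn n N)).1 (s n).1.
  by rewrite (cmod_distC z (s (maxn n N)).1); lra.
have [d d0 dP] := locP z (zs 0%N).
have [N NP] := div_pow2_small (cmod u) d d0.
by apply: (nPs N); apply: dP => //; rewrite s2 NP.
Qed.

End Bisection.

(** * Goursat's lemma *)

Section Goursat.
Context {R : realType}.
Implicit Types (z w c a u v p q : Cplx R) (f g : Cplx R -> Cplx R) (e B : R).

(** Left Riemann sum of the integral of [f] along the segment from [a] to [a + u]. With [2 ^ n]
    steps, halving the segment is an exact identity. *)
Definition edge_sum n f a u : Cplx R :=
  \sum_(0 <= j < 2 ^ n) f (a + j%:R / 2 ^+ n * u) * (u / 2 ^+ n).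

(** Boundary of the parallelogram with corner [a] and sides [u], [v]. Opposite edges are sampled in
    the same direction and subtracted, so neighbouring parallelograms use the same sample points on
    a common edge. *)
Definition square_sum n f a u v : Cplx R :=
  edge_sum n f a u + edge_sum n f (a + u) v - edge_sum n f (a + v) u - edge_sum n f a v.

Lemma edge_sum_split n f a u :
  edge_sum n.+1 f a u = edge_sum n f a (u / 2) + edge_sum n f (a + u / 2) (u / 2).
Proof.
have n0 : 2 ^+ n != 0 :> Cplx R by rewrite expf_neq0 // pnatr_eq0.
rewrite /edge_sum expnS mul2n -addnn.
rewrite (big_cat_nat (leq0n _) (leq_addr _ _)) /=; congr (_ + _).
  by apply: eq_bigr => j _; congr (f _ * _); rewrite exprS; field.
rewrite -{1}(add0n (2 ^ n)%N) big_addn addnK; apply: eq_bigr => j _.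
by congr (f _ * _); rewrite exprS ?natrD ?natrX; field.
Qed.

(** Each inner edge occurs twice with opposite signs and the same sample points, so the cancellation
    is exact at every level. *)
Lemma square_sum_split n f a u v :
  square_sum n.+1 f a u v =
    square_sum n f a (u / 2) (v / 2) + square_sum n f (a + u / 2) (u / 2) (v / 2) +
    square_sum n f (a + v / 2) (u / 2) (v / 2) +
    square_sum n f (a + u / 2 + v / 2) (u / 2) (v / 2).
Proof.
rewrite /square_sum !edge_sum_split.
rewrite (_ : a + u / 2 + u / 2 = a + u); last by field.
rewrite (_ : a + v / 2 + v / 2 = a + v); last by field.
rewrite (_ : a + v + u / 2 = a + u / 2 + v); last by ring.
rewrite (_ : a + u / 2 + v / 2 + v / 2 = a + u / 2 + v); last by field.
rewrite (_ : a + u / 2 + v / 2 + u / 2 = a + u + v / 2); last by field.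
rewrite (_ : a + v / 2 + u / 2 = a + u / 2 + v / 2); last by ring.
by ring.
Qed.

Lemma edge_sumD n f g a u :
  edge_sum n (fun z => f z + g z) a u = edge_sum n f a u + edge_sum n g a u.
Proof. by rewrite /edge_sum -big_split; apply: eq_bigr => j _; rewrite mulrDl. Qed.

Lemma edge_sumZ n p f a u :
  edge_sum n (fun z => p * f z) a u = p * edge_sum n f a u.
Proof. by rewrite /edge_sum mulr_sumr; apply: eq_bigr => j _; rewrite -mulrA. Qed.

Lemma edge_sum_cst n p a u : edge_sum n (fun=> p) a u = p * u.
Proof.
have n0 : 2 ^+ n != 0 :> Cplx R by rewrite expf_neq0 // pnatr_eq0.
rewrite /edge_sum big_const_nat subn0 iter_addr_0 -[LHS]mulr_natl natrX; field.
exact: n0.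
Qed.

Lemma edge_sum_shift n a u v :
  edge_sum n id (a + v) u = edge_sum n id a u + v * u.
Proof.
rewrite -(edge_sum_cst n v a u) -edge_sumD /edge_sum.
by apply: eq_bigr => j _; congr (_ * _); ring.
Qed.

Lemma square_sumD n f g a u v :
  square_sum n (fun z => f z + g z) a u v = square_sum n f a u v + square_sum n g a u v.
Proof. by rewrite /square_sum !edge_sumD; ring. Qed.

(** Exact for every [n], not only in the limit: for the identity, the two pairs of opposite edges
    differ by [v * u] and [u * v], which cancel. *)
Lemma square_sum_affine n p q a u v : square_sum n (fun z => p + q * z) a u v = 0.
Proof.
rewrite square_sumD /square_sum !edge_sum_cst !(edge_sumZ n q (fun z => z)).
by rewrite !edge_sum_shift; ring.
Qed.

Lemma edge_sum_bound n f a u B :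
  (forall t : R, 0 <= t < 1 -> cmod (f (a + ofR t * u)) <= B) ->
  cmod (edge_sum n f a u) <= B * cmod u.
Proof.
move=> fB; have n0 : (0 : R) < 2 ^+ n by rewrite exprn_gt0.
apply: (le_trans (cmod_sum _ _ _ _)).
apply: (@le_trans _ _ (\sum_(0 <= j < 2 ^ n) B * (cmod u / 2 ^+ n))).
  rewrite big_nat [leRHS]big_nat; apply: ler_sum => j /andP[_ jn].
  rewrite cmodM cmodM cmodV cmodX -(ofR_nat 2) (_ : cmod (ofR 2%:R) = 2 :> R); last first.
    by rewrite cmod_ofR ger0_norm.
  apply: ler_wpM2r; first by rewrite divr_ge0 ?cmod_ge0 ?ltW.
  have := fB (j%:R / 2 ^+ n); rewrite ofRM ofRV ofRX !ofR_nat; apply.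
  by rewrite divr_ge0 ?(ltW n0) // ltr_pdivrMr // mul1r -natrX ltr_nat.
rewrite big_const_nat subn0 iter_addr_0 -[leLHS]mulr_natl natrX.
rewrite le_eqVlt; apply/orP; left; apply/eqP; field.
by rewrite gt_eqF.
Qed.

(* The property bisected is [|square_sum| <= e |u|^2] for all large [n]: it is
   additive, and holds near each point because [f] is affine there up to
   [o(|u|)] while [square_sum] kills affine functions. *)
Lemma goursat f c u :
  (forall z, cmod (z - c) <= 3 / 2 * cmod u -> derivable f z 1) ->
  forall e, 0 < e -> exists N, forall n, (N <= n)%N ->
    cmod (square_sum n f (c - (1 + ci) * u) (2 * u) (2 * (ci * u))) <= e.
Proof.
(* The summand 1 keeps the denominator positive when [u = 0]. *)
move=> fD e e0; pose k := e / (1 + cmod u ^+ 2).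
have u20 : 0 < 1 + cmod u ^+ 2 by rewrite ltr_pwDl // exprn_ge0 // cmod_ge0.
have k0 : 0 < k by rewrite divr_gt0.
pose P c u := exists N, forall n, (N <= n)%N ->
  cmod (square_sum n f (c - (1 + ci) * u) (2 * u) (2 * (ci * u))) <= k * cmod u ^+ 2.
suff [N NP] : P c u.
  exists N => n /NP/le_trans; apply; rewrite mulrAC ler_pdivrMr //.
  by rewrite ler_pM2l // lerDr.
apply: square_bisection => [b v|z /fD/derivable_diffquo[l fl]].
  move=> [N1 P1] [N2 P2] [N3 P3] [N4 P4].
  (* The successor pays for the level used by [square_sum_split]. The four bounds with [v / 2] add
     up to the one with [v]. *)
  exists (maxn (maxn N1 N2) (maxn N3 N4)).+1 => -[//|n].
  rewrite ltnS !geq_max => /andP[/andP[/P1 + /P2 +] /andP[/P3 + /P4 +]].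
  rewrite cmod_half square_sum_split.
  rewrite (_ : 2 * v / 2 = 2 * (v / 2)); last by field.
  rewrite (_ : 2 * (ci * v) / 2 = 2 * (ci * (v / 2))); last by field.
  rewrite (_ : b + (1 + ci) * v / 2 - (1 + ci) * (v / 2) =
    b - (1 + ci) * v + 2 * (v / 2) + 2 * (ci * (v / 2))); last by field.
  rewrite (_ : b + (1 - ci) * v / 2 - (1 + ci) * (v / 2) =
    b - (1 + ci) * v + 2 * (v / 2)); last by field.
  rewrite (_ : b - (1 + ci) * v / 2 - (1 + ci) * (v / 2) =
    b - (1 + ci) * v); last by field.
  rewrite (_ : b - (1 - ci) * v / 2 - (1 + ci) * (v / 2) =
    b - (1 + ci) * v + 2 * (ci * (v / 2))); last by field.
  rewrite expr_div_n => h1 h2 h3 h4.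
  set x1 := square_sum n f (b - _) _ _ in h3 *.
  set x2 := square_sum n f _ _ _ in h2 *.
  set x3 := square_sum n f _ _ _ in h4 *.
  set x4 := square_sum n f _ _ _ in h1 *.
  have := cmodD (x1 + x2 + x3) x4; have := cmodD (x1 + x2) x3; have := cmodD x1 x2.
  lra.
(* At distance at most [5 * cmod u'] the affine error is [k / 8 * cmod u']; an edge of length
   [2 * cmod u'] then costs a quarter of the allowed [k * cmod u' ^+ 2]. *)
have e20 : 0 < k / 40 by rewrite divr_gt0.
have [d d0 dP] := fl _ e20; exists (d / 5); first by rewrite divr_gt0.
move=> c' u' zc' u'd; exists 0%N => n _.
have near_aff w : cmod (w - z) <= 5 * cmod u' ->
    cmod (f w - (f z - l * z + l * w)) <= k / 8 * cmod u'.
  move=> wz; have [->|w_neq] := eqVneq w z.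
    by rewrite subrK subrr cmod0 mulr_ge0 ?cmod_ge0 // divr_ge0 // ltW.
  have wz0 : w - z != 0 by rewrite subr_eq0.
  have -> : f w - (f z - l * z + l * w) = ((f w - f z) / (w - z) - l) * (w - z) by field.
  have /dP/(_ w_neq) h : cmod (w - z) < d by lra.
  rewrite cmodM; apply: (le_trans (ler_pM (cmod_ge0 _) (cmod_ge0 _) h wz)); lra.
pose r w := f w - (f z - l * z + l * w).
have -> a v1 v2 : square_sum n f a v1 v2 = square_sum n r a v1 v2.
  rewrite -[RHS]addr0 -(square_sum_affine n (f z - l * z) l a v1 v2) -square_sumD.
  by congr square_sum; apply/funext => w; rewrite /r subrK.
have edge a v : cmod (a - c') <= 3 / 2 * cmod u' -> cmod v = cmod u' ->
    cmod (edge_sum n r a (2 * v)) <= k / 4 * cmod u' ^+ 2.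
  move=> ac vu; have -> : k / 4 * cmod u' ^+ 2 = k / 8 * cmod u' * cmod (2 * v).
    by rewrite cmodM vu -(ofR_nat 2) cmod_ofR ger0_norm //; field.
  apply: edge_sum_bound => t /andP[t0 t1]; apply: near_aff.
  (* From the centre to the edge, along it, and from the centre to [z]: [3 / 2 + 2 + 3 / 2 = 5]. *)
  have -> : a + ofR t * (2 * v) - z = (a - c') + ofR t * (2 * v) - (z - c') by ring.
  apply: (le_trans (cmodB _ _)); have := cmodD (a - c') (ofR t * (2 * v)).
  rewrite !cmodM -(ofR_nat 2) !cmod_ofR !ger0_norm // vu.
  have : t * cmod u' <= cmod u' by rewrite ler_piMl ?cmod_ge0 // ltW.
  lra.
have diag v : cmod v <= 3 / 2 -> cmod (v * u') <= 3 / 2 * cmod u'.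
  by move=> h; rewrite cmodM ler_wpM2r ?cmod_ge0.
have ciu : cmod (ci * u') = cmod u' by rewrite cmodM cmod_ci mul1r.
have h1 : cmod (edge_sum n r (c' - (1 + ci) * u') (2 * u')) <= k / 4 * cmod u' ^+ 2.
  apply: edge => //; rewrite (_ : _ - c' = - (1 + ci) * u'); last by ring.
  by apply: diag; rewrite cmodN cmod_1Dci.
have h2 : cmod (edge_sum n r (c' - (1 + ci) * u' + 2 * u') (2 * (ci * u'))) <=
    k / 4 * cmod u' ^+ 2.
  apply: edge => //; rewrite (_ : _ - c' = (1 - ci) * u'); last by ring.
  exact/diag/cmod_1Bci.
have h3 : cmod (edge_sum n r (c' - (1 + ci) * u' + 2 * (ci * u')) (2 * u')) <=
    k / 4 * cmod u' ^+ 2.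
  apply: edge => //; rewrite (_ : _ - c' = - (1 - ci) * u'); last by ring.
  by apply: diag; rewrite cmodN cmod_1Bci.
have h4 : cmod (edge_sum n r (c' - (1 + ci) * u') (2 * (ci * u'))) <= k / 4 * cmod u' ^+ 2.
  apply: edge => //; rewrite (_ : _ - c' = - (1 + ci) * u'); last by ring.
  by apply: diag; rewrite cmodN cmod_1Dci.
rewrite /square_sum.
set x1 := edge_sum n r (c' - _) (2 * u') in h1 *; set x2 := edge_sum _ _ _ _ in h2 *.
set x3 := edge_sum _ _ _ _ in h3 *; set x4 := edge_sum n r (c' - _) _ in h4 *.
have := cmodB (x1 + x2 - x3) x4; have := cmodB (x1 + x2) x3; have := cmodD x1 x2.
lra.
Qed.

End Goursat.

(** * Squares with a singular corner *)

Section MeanBound.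
Context {R : realType}.
Implicit Types (z w c a u v p q : Cplx R) (f g : Cplx R -> Cplx R) (e B M d s x y : R).

(** Goursat's lemma for a square described by a corner and a side instead of centre and
    half-side. *)
Lemma goursat_at f a u :
  (forall z, cmod (z - (a + (1 + ci) * (u / 2))) <= 3 / 4 * cmod u -> derivable f z 1) ->
  forall e, 0 < e -> exists N, forall n, (N <= n)%N ->
    cmod (square_sum n f a u (ci * u)) <= e.
Proof.
move=> fD e e0.
have [|N NP] := @goursat _ f (a + (1 + ci) * (u / 2)) (u / 2) _ e e0.
  by move=> z; rewrite cmod_half => h; apply: fD; lra.
exists N => n /NP; rewrite addrK.
rewrite (_ : 2 * (u / 2) = u); last by field.
by rewrite (_ : 2 * (ci * (u / 2)) = ci * u); last by field.
Qed.

Lemma cmod_le_coord x y : cmod (ofR x + ofR y * ci) <= `|x| + `|y|.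
Proof. by rewrite (le_trans (cmodD _ _)) // cmodM cmod_ci mulr1 !cmod_ofR. Qed.

Lemma square_sum_bound n f a u M :
  (forall z, cmod (z - a) <= 2 * cmod u -> cmod (f z) <= M) ->
  cmod (square_sum n f a u (ci * u)) <= 4 * M * cmod u.
Proof.
move=> fM; have ciu : cmod (ci * u) = cmod u by rewrite cmodM cmod_ci mul1r.
have edge b v : cmod (b - a) <= cmod u -> cmod v = cmod u ->
    cmod (edge_sum n f b v) <= M * cmod u.
  move=> bu vu; rewrite -vu; apply: edge_sum_bound => t /andP[t0 t1]; apply: fM.
  rewrite (_ : b + _ - a = b - a + ofR t * v); last by ring.
  apply: (le_trans (cmodD _ _)); rewrite cmodM cmod_ofR ger0_norm // vu.
  have : t * cmod u <= cmod u by rewrite ler_piMl ?cmod_ge0 // ltW.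
  lra.
have h1 : cmod (edge_sum n f a u) <= M * cmod u.
  by apply: edge; rewrite // subrr cmod0 cmod_ge0.
have h2 : cmod (edge_sum n f (a + u) (ci * u)) <= M * cmod u.
  by apply: edge; rewrite // addrC addKr.
have h3 : cmod (edge_sum n f (a + ci * u) u) <= M * cmod u.
  by apply: edge; rewrite // addrC addKr ciu.
have h4 : cmod (edge_sum n f a (ci * u)) <= M * cmod u.
  by apply: edge; rewrite // subrr cmod0 cmod_ge0.
rewrite /square_sum.
have := cmodB (edge_sum n f a u + edge_sum n f (a + u) (ci * u) -
  edge_sum n f (a + ci * u) u) (edge_sum n f a (ci * u)).
have := cmodB (edge_sum n f a u + edge_sum n f (a + u) (ci * u))
  (edge_sum n f (a + ci * u) u).
have := cmodD (edge_sum n f a u) (edge_sum n f (a + u) (ci * u)).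
lra.
Qed.

(** Meant for the three quarters that avoid the singular corner [w]. The disc around such a quarter
    has radius [3 / 8 * cmod u], and its centre is between [3 / 4 * cmod u] and [3 / 2 * cmod u]
    away from [w], so it misses [w] and stays within [2 * cmod u]. *)
Lemma goursat_off_corner f w u x y : u != 0 ->
  (forall z, z != w -> cmod (z - w) <= 2 * cmod u -> derivable f z 1) ->
  3 / 4 <= `|x| \/ 3 / 4 <= `|y| -> `|x| + `|y| <= 3 / 2 ->
  forall a, a + (1 + ci) * (u / 2 / 2) = w + (ofR x + ofR y * ci) * u ->
  forall e, 0 < e -> exists N, forall n, (N <= n)%N ->
    cmod (square_sum n f a (u / 2) (ci * (u / 2))) <= e.
Proof.
move=> u0 fD xy34 xy32 a aE; have u_gt0 : 0 < cmod u by rewrite cmod_gt0.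
have qlo : 3 / 4 <= cmod (ofR x + ofR y * ci).
  by case: xy34 => /le_trans; apply; rewrite ?cmod_geRe ?cmod_geIm.
have qhi := le_trans (cmod_le_coord x y) xy32.
apply: goursat_at => z; rewrite aE cmod_half => zq.
have := ler_wpM2r (ltW u_gt0) qlo; have := ler_wpM2r (ltW u_gt0) qhi.
rewrite -cmodM; set qu := (_ * u) in zq * => hi lo.
apply: fD.
  apply: contraTneq zq => ->; rewrite -ltNge.
  by rewrite (_ : w - _ = - qu) ?cmodN; [lra|ring].
by have := cmodD (z - (w + qu)) qu; rewrite (_ : z - _ + qu = z - w); [lra|ring].
Qed.

(** Repeated subdivision towards [w]: the other quarters contribute nothing in the limit, and the
    last square, of side [u / 2 ^+ k], at most [4 * M] times its side. *)
Lemma goursat_corner f w u M d : 0 < d -> u != 0 ->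
  (forall z, cmod (z - w) < d -> cmod (f z) <= M) ->
  (forall z, z != w -> cmod (z - w) <= 2 * cmod u -> derivable f z 1) ->
  forall e, 0 < e -> exists N, forall n, (N <= n)%N ->
    cmod (square_sum n f w u (ci * u)) <= e.
Proof.
move=> d0 + fM.
have shrink k : forall v e e', v != 0 ->
    (forall z, z != w -> cmod (z - w) <= 2 * cmod v -> derivable f z 1) ->
    (forall n, cmod (square_sum n f w (v / 2 ^+ k) (ci * (v / 2 ^+ k))) <= e) -> e < e' ->
    exists N, forall n, (N <= n)%N -> cmod (square_sum n f w v (ci * v)) <= e'.
  elim: k => [v e e' _ _|k IH v e e' v0 vD].
    by rewrite expr0 divr1 => h /ltW ee'; exists 0%N => n _; rewrite (le_trans (h n)).
  have -> : v / 2 ^+ k.+1 = v / 2 / 2 ^+ k by rewrite exprS invfM mulrA.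
  move=> h ee'.
  (* The gap [e' - e] is shared out: one half to the corner quarter, one sixth to each of the other
     three. *)
  have [|z zw zv||N0 P0] := IH (v / 2) e ((e + e') / 2) _ _ h.
  - by rewrite mulf_neq0 // invr_eq0 pnatr_eq0.
  - by apply: vD => //; rewrite cmod_half in zv; have := cmod_ge0 v; lra.
  - lra.
  have e60 : 0 < (e' - e) / 6 by lra.
  have n34 : `|3 / 4 : R| = 3 / 4 by rewrite ger0_norm.
  have n14 : `|1 / 4 : R| = 1 / 4 by rewrite ger0_norm.
  have c34 : ofR (3 / 4) = 3 / 4 :> Cplx R by rewrite ofRM ofRV !ofR_nat.
  have c14 : ofR (1 / 4) = 1 / 4 :> Cplx R by rewrite ofRM ofRV !ofR_nat.
  have [|||N1 P1] := @goursat_off_corner f w v (3 / 4) (1 / 4) v0 vD _ _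
    (w + v / 2) _ _ e60.
  - by left; rewrite n34.
  - by rewrite n34 n14; lra.
  - by rewrite c34 c14; field.
  have [|||N2 P2] := @goursat_off_corner f w v (1 / 4) (3 / 4) v0 vD _ _
    (w + ci * v / 2) _ _ e60.
  - by right; rewrite n34.
  - by rewrite n34 n14; lra.
  - by rewrite c34 c14; field.
  have [|||N3 P3] := @goursat_off_corner f w v (3 / 4) (3 / 4) v0 vD _ _
    (w + v / 2 + ci * v / 2) _ _ e60.
  - by left; rewrite n34.
  - by rewrite n34; lra.
  - by rewrite c34; field.
  exists (maxn (maxn N0 N1) (maxn N2 N3)).+1 => -[//|n].
  rewrite ltnS !geq_max => /andP[/andP[/P0 + /P1 +] /andP[/P2 + /P3 +]].
  rewrite square_sum_split mulrA => h0 h1 h2 h3.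
  set x0 := square_sum n f w _ _ in h0 *.
  set x1 := square_sum n f _ _ _ in h1 *.
  set x2 := square_sum n f _ _ _ in h2 *.
  set x3 := square_sum n f _ _ _ in h3 *.
  have := cmodD (x0 + x1 + x2) x3; have := cmodD (x0 + x1) x2; have := cmodD x0 x1.
  lra.
move=> u0 fD e e0.
have M0 : 0 <= M by rewrite (le_trans (cmod_ge0 (f w))) // fM // subrr cmod0.
have [N1 P1] := div_pow2_small (2 * cmod u) d d0.
have e20 : 0 < e / 2 by rewrite divr_gt0.
have [N2 P2] := div_pow2_small (4 * M * cmod u) (e / 2) e20.
(* [N1] brings the last square into the disc where [f] is bounded; [N2] makes its sum smaller than
   [e / 2]. *)
pose k := maxn N1 N2.
have uk : cmod (u / 2 ^+ k) = cmod u / 2 ^+ k.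
  by rewrite cmodM cmodV cmodX -(ofR_nat 2) cmod_ofR ger0_norm.
apply: (shrink k u (e / 2)) => // [n|]; last by lra.
apply: (@le_trans _ _ (4 * M * cmod (u / 2 ^+ k))).
  apply: square_sum_bound => z zw; apply: fM; apply: (le_lt_trans zw).
  by rewrite uk mulrA P1 // leq_maxl.
by rewrite uk mulrA ltW // P2 // leq_maxr.
Qed.

End MeanBound.

(** * The maximum principle *)

Section MaximumPrinciple.
Context {R : realType}.
Implicit Types (z w a u v : Cplx R) (f g p : Cplx R -> Cplx R) (e B M d s x y t : R).

Lemma derivable_mul f g z : derivable f z 1 -> derivable g z 1 ->
  derivable (fun w => f w * g w) z 1.
Proof. exact: derivableM. Qed.

Lemma derivable_sub f g z : derivable f z 1 -> derivable g z 1 ->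
  derivable (fun w => f w - g w) z 1.
Proof. exact: derivableB. Qed.

Lemma derivable_const a z : derivable (fun=> a) z 1.
Proof. exact: derivable_cst. Qed.

Lemma derivable_inv f z : f z != 0 -> derivable f z 1 ->
  derivable (fun w => (f w)^-1) z 1.
Proof. exact: derivableV. Qed.

Lemma derivable_subc a z : derivable (fun w => w - a) z 1.
Proof. by apply: derivable_sub; [exact: derivable_id|exact: derivable_const]. Qed.

Lemma continuous_mul f g z : {for z, continuous f} -> {for z, continuous g} ->
  {for z, continuous (fun w => f w * g w)}.
Proof. exact: continuousM. Qed.

Lemma continuous_sub f g z : {for z, continuous f} -> {for z, continuous g} ->
  {for z, continuous (fun w => f w - g w)}.
Proof. exact: continuousB. Qed.

Lemma continuous_exp f z n : {for z, continuous f} ->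
  {for z, continuous (fun w => f w ^+ n)}.
Proof.
move=> fz; elim: n => [|n IH]; first exact: cst_continuous.
rewrite (_ : (fun w => _) = (fun w => f w * f w ^+ n)); last first.
  by apply/funext => w; rewrite exprS.
exact: (continuous_mul f (fun w => f w ^+ n) z fz IH).
Qed.

Lemma derivable_exp f z n : derivable f z 1 -> derivable (fun w => f w ^+ n) z 1.
Proof.
move=> fz; elim: n => [|n IH]; first exact: (derivable_const 1 z).
rewrite (_ : (fun w => _) = (fun w => f w * f w ^+ n)); last first.
  by apply/funext => w; rewrite exprS.
exact: (derivable_mul f (fun w => f w ^+ n) z fz IH).
Qed.

(** Since [p z = 0], the difference quotient of the product is [f w] times that of [p], so
    continuity of [f] suffices. *)
Lemma derivable_mul_zero f p z : {for z, continuous f} -> derivable p z 1 -> p z = 0 ->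
  derivable (fun w => f w * p w) z 1.
Proof.
move=> fz pD pz; apply/derivable_diffquo; exists (f z * diffquo p z z) => e.
have := continuous_mul f (diffquo p z) z fz (diffquo_cvg p z pD).
move=> /continuous_cmod h /h[d d0 dP]; exists d => // w wz w_neq.
have := dP w wz; rewrite {1}/diffquo (negbTE w_neq) pz mulr0 !subr0 => h1.
by rewrite -mulrA.
Qed.

(** The contribution of the two edges that do not meet the corner [w] of the square with side
    [u]. *)
Definition outer_sum n f w u : Cplx R :=
  edge_sum n f (w + u) (ci * u) - edge_sum n f (w + ci * u) u.

(** Four quarter turns of the square tile a larger one centred at [w]. The edges issuing from [w]
    cancel in pairs, leaving the outer boundary. *)
Lemma square_sum_rotations n f w u :
  square_sum n f w u (ci * u) + square_sum n f w (ci * u) (ci * (ci * u)) +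
  square_sum n f w (ci * (ci * u)) (ci * (ci * (ci * u))) +
  square_sum n f w (ci * (ci * (ci * u))) (ci * (ci * (ci * (ci * u)))) =
  outer_sum n f w u + outer_sum n f w (ci * u) + outer_sum n f w (ci * (ci * u)) +
  outer_sum n f w (ci * (ci * (ci * u))).
Proof.
rewrite /square_sum /outer_sum.
have -> : ci * (ci * (ci * (ci * u))) = u by rewrite !mulrA ci2 -(mulrA (-1)) ci2; ring.
by ring.
Qed.

Lemma outer_sum_bound n f w u B :
  (forall z, cmod u <= cmod (z - w) <= 2 * cmod u -> cmod (f z) <= B) ->
  cmod (outer_sum n f w u) <= 2 * B * cmod u.
Proof.
move=> fB; have ciu : cmod (ci * u) = cmod u by rewrite cmodM cmod_ci mul1r.
have q x y : `|x| = 1 \/ `|y| = 1 -> `|x| + `|y| <= 2 ->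
    cmod u <= cmod ((ofR x + ofR y * ci) * u) <= 2 * cmod u.
  move=> xy1 xy2; rewrite cmodM ler_peMl ?cmod_ge0 ?andTb //.
    by rewrite ler_wpM2r ?cmod_ge0 // (le_trans (cmod_le_coord x y)).
  by case: xy1 => <-; [exact: cmod_geRe|exact: cmod_geIm].
have h1 : cmod (edge_sum n f (w + u) (ci * u)) <= B * cmod u.
  rewrite -ciu; apply: edge_sum_bound => t /andP[t0 t1]; apply: fB.
  rewrite (_ : _ - w = (ofR 1 + ofR t * ci) * u); last by rewrite ofR1; ring.
  by apply: q; [left; rewrite normr1|rewrite normr1 ger0_norm //; lra].
have h2 : cmod (edge_sum n f (w + ci * u) u) <= B * cmod u.
  apply: edge_sum_bound => t /andP[t0 t1]; apply: fB.
  rewrite (_ : _ - w = (ofR t + ofR 1 * ci) * u); last by rewrite ofR1; ring.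
  by apply: q; [right; rewrite normr1|rewrite normr1 ger0_norm //; lra].
have := cmodB (edge_sum n f (w + u) (ci * u)) (edge_sum n f (w + ci * u) u).
rewrite /outer_sum; lra.
Qed.

(** Used with [a = 1 + t * i] and [b = 1 - t * i], so that [a * b = 1 + t ^+ 2]: it pairs the sample
    [u * a] of one outer edge with the sample [u * (i * b)] of the other. *)
Lemma kernel_identity (F : fieldType) (i u a b N : F) :
  i * i = -1 -> i != 0 -> u != 0 -> a != 0 -> b != 0 -> N != 0 -> a + b = 2 ->
  (u * a)^-1 * (i * u / N) - (u * (i * b))^-1 * (u / N) = i * (2 / (a * b) / N).
Proof.
move=> i2 i0 u0 a0 b0 N0 <-; have iV : i^-1 = - i.
  by apply: (mulfI i0); rewrite mulrN i2 opprK divff.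
by rewrite !invfM iV; field; rewrite a0 b0 u0 N0.
Qed.

(* The exact value is the Riemann sum of [2 ci / (1 + t^2)] over [0, 1], whose
   quadruple tends to [2 pi ci]. *)
Lemma outer_sum_kernel n w : exists2 x : R, 1 <= x &
  forall u, u != 0 -> outer_sum n (fun z => (z - w)^-1) w u = ci * ofR x.
Proof.
have [t tE] : exists t : nat -> R, forall j, t j = j%:R / 2 ^+ n by eexists.
have n0 : (0 : R) < 2 ^+ n by rewrite exprn_gt0.
have t2 j : 0 < 1 + t j ^+ 2 by rewrite ltr_pwDl // sqr_ge0.
exists (\sum_(0 <= j < 2 ^ n) 2 / (1 + t j ^+ 2) * (2 ^+ n)^-1) => [|u u0].
  apply: (@le_trans _ _ (\sum_(0 <= j < 2 ^ n) (2 ^+ n)^-1 : R)).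
    rewrite big_const_nat subn0 iter_addr_0 -[leRHS]mulr_natl natrX.
    by rewrite divff // gt_eqF.
  (* Each factor [2 / (1 + t j ^+ 2)] is at least 1 because [t j] lies in [0, 1]. *)
  rewrite big_nat [leRHS]big_nat; apply: ler_sum => j /andP[_ jn].
  rewrite ler_peMl ?invr_ge0 ?(ltW n0) // ler_pdivlMr // mul1r.
  have t0 : 0 <= t j by rewrite tE divr_ge0 ?(ltW n0).
  have t1 : t j <= 1 by rewrite tE ler_pdivrMr // mul1r -natrX ler_nat ltnW.
  have := exprn_ile1 2 t0 t1; lra.
rewrite /outer_sum /edge_sum (big_morph ofR ofRD ofR0) mulr_sumr -sumrB.
apply: eq_bigr => j _.
have -> : j%:R / 2 ^+ n = ofR (t j) by rewrite tE ofRM ofRV ofRX !ofR_nat.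
have tc : 1 + ofR (t j) ^+ 2 = (1 + ofR (t j) * ci) * (1 - ofR (t j) * ci).
  by have c2 := ci2 (R := R); ring: c2.
have : 1 + ofR (t j) ^+ 2 != 0.
  by rewrite -ofRX -ofR1 -ofRD ofR_eq0 gt_eqF.
rewrite tc mulf_eq0 negb_or => /andP[d1 d2].
rewrite !(ofRM, ofRV, ofRD, ofRX, ofR1, ofR_nat) tc.
rewrite (_ : w + u + _ - w = u * (1 + ofR (t j) * ci)); last by ring.
rewrite (_ : w + ci * u + _ - w = u * (ci * (1 - ofR (t j) * ci))); last first.
  by have c2 := ci2 (R := R); ring: c2.
have n0c : 2 ^+ n != 0 :> Cplx R by rewrite expf_neq0 // pnatr_eq0.
have c0 := @ci_neq0 R.
have tc2 : (1 + ofR (t j) * ci) + (1 - ofR (t j) * ci) = 2 by ring.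
exact: (kernel_identity _ _ _ _ _ _ (@ci2 R) c0 u0 d1 d2 n0c tc2).
Qed.

(** Cauchy's formula with Riemann sums. The sums of [(f z - f w) / (z - w)] around the four squares
    at [w] tend to 0, while the kernel contributes [4 * x * ci * f w] with [1 <= x] and the outer
    sums of [f z / (z - w)] are at most [2 * B] each. *)
Lemma weak_maximum f w s B : 0 < s ->
  (forall z, cmod (z - w) <= 2 * s -> derivable f z 1) ->
  (forall z, s <= cmod (z - w) <= 2 * s -> cmod (f z) <= B) ->
  cmod (f w) <= 2 * B.
Proof.
move=> s0 fD fB; pose u := ofR s.
have us : cmod u = s by rewrite cmod_ofR ger0_norm // ltW.
have u0 : u != 0 by rewrite -cmod_gt0 us.
pose g z := (f z - f w) * (z - w)^-1.
have [M [d d0 gM]] : exists M, exists2 d, 0 < d & forall z, cmod (z - w) < d -> cmod (g z) <= M.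
  have [|l /(_ 1 ltr01)[d d0 dP]] := (derivable_diffquo f w).1.
    by apply: fD; rewrite subrr cmod0; lra.
  (* At [w] itself [g] is 0, as the numerator vanishes. *)
  exists (cmod l + 1), d => // z zw; have [->|zw_neq] := eqVneq z w.
    by rewrite /g subrr mul0r cmod0 addr_ge0 ?cmod_ge0.
  have := dP z zw zw_neq; have := cmodD (g z - l) l; rewrite subrK /g; lra.
have gD v : cmod v = s -> forall z, z != w -> cmod (z - w) <= 2 * cmod v -> derivable g z 1.
  move=> vs z zw; rewrite vs => /fD fz; apply: derivable_mul.
    exact: (derivable_sub f (fun=> f w) z fz (derivable_const _ _)).
  apply: (derivable_inv (fun v => v - w)); first by rewrite subr_eq0.
  exact: derivable_subc.
have rot v : cmod (ci * v) = cmod v by rewrite cmodM cmod_ci mul1r.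
have nz v : cmod v = s -> v != 0 by rewrite -cmod_gt0 => ->.
have u1 : cmod (ci * u) = s by rewrite rot.
have u2 : cmod (ci * (ci * u)) = s by rewrite !rot.
have u3 : cmod (ci * (ci * (ci * u))) = s by rewrite !rot.
have small v e : cmod v = s -> 0 < e -> exists N, forall n, (N <= n)%N ->
    cmod (square_sum n g w v (ci * v)) <= e.
  by move=> vs; exact: (goursat_corner g w v M d d0 (nz v vs) gM (gD v vs)).
suff main e : 0 < e -> cmod (f w) <= 2 * B + e by apply/ler_addgt0Pr => e /main.
move=> e0.
have [N0 P0] := small _ e us e0; have [N1 P1] := small _ e u1 e0.
have [N2 P2] := small _ e u2 e0; have [N3 P3] := small _ e u3 e0.
pose n := maxn (maxn N0 N1) (maxn N2 N3).
have /P0 p0 : (N0 <= n)%N by rewrite /n !leq_max leqnn.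
have /P1 p1 : (N1 <= n)%N by rewrite /n !leq_max leqnn orbT.
have /P2 p2 : (N2 <= n)%N by rewrite /n !leq_max leqnn !orbT.
have /P3 p3 : (N3 <= n)%N by rewrite /n !leq_max leqnn !orbT.
have [x x1 kx] := outer_sum_kernel n w.
have outer v : cmod v = s -> exists2 y, cmod y <= 2 * B &
    outer_sum n g w v = y - f w * (ci * ofR x).
  move=> vs; have v0 := nz v vs.
  exists (outer_sum n (fun z => f z * (z - w)^-1) w v).
    rewrite (_ : 2 * B = 2 * (B / s) * cmod v); last by rewrite vs; field; rewrite gt_eqF.
    apply: outer_sum_bound => z; rewrite vs => /andP[z1 z2].
    rewrite cmodM cmodV ler_pM ?invr_ge0 ?cmod_ge0 ?fB ?z1 //.
    by rewrite lef_pV2 // posrE (lt_le_trans s0).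
  rewrite -(kx v v0) -mulNr /outer_sum mulrBr -!edge_sumZ.
  have -> : g = (fun z => f z * (z - w)^-1 + - f w * (z - w)^-1).
    by apply/funext => z; rewrite /g mulrBl mulNr.
  by rewrite !edge_sumD; ring.
have [y0 y0B o0] := outer _ us; have [y1 y1B o1] := outer _ u1.
have [y2 y2B o2] := outer _ u2; have [y3 y3B o3] := outer _ u3.
have := square_sum_rotations n g w u; rewrite o0 o1 o2 o3 => sumE.
set S0 := square_sum n g w u _ in p0 sumE.
set S1 := square_sum n g w (ci * u) _ in p1 sumE.
set S2 := square_sum n g w (ci * (ci * u)) _ in p2 sumE.
set S3 := square_sum n g w (ci * (ci * (ci * u))) _ in p3 sumE.
have E : ofR 4 * ofR x * ci * f w = y0 + y1 + y2 + y3 - (S0 + S1 + S2 + S3).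
  by rewrite sumE ofR_nat; ring.
have : cmod (ofR 4 * ofR x * ci * f w) <= 8 * B + 4 * e.
  rewrite E; have := cmodB (y0 + y1 + y2 + y3) (S0 + S1 + S2 + S3).
  have := cmodD (y0 + y1 + y2) y3; have := cmodD (y0 + y1) y2; have := cmodD y0 y1.
  have := cmodD (S0 + S1 + S2) S3; have := cmodD (S0 + S1) S2; have := cmodD S0 S1.
  lra.
rewrite !cmodM cmod_ci !cmod_ofR !ger0_norm //; last lra.
have : cmod (f w) <= x * cmod (f w) by rewrite ler_peMl ?cmod_ge0.
lra.
Qed.

Lemma exprn_bernoulli x n : 0 <= x -> 1 + n%:R * x <= (1 + x) ^+ n.
Proof.
move=> x0; elim: n => [|n IH]; first by rewrite mul0r addr0 expr0.
have x1 : 0 <= 1 + x by lra.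
rewrite exprS; apply: le_trans (ler_wpM2l x1 IH).
rewrite -natr1; have : 0 <= n%:R * x * x by rewrite !mulr_ge0.
lra.
Qed.

(** If [x = B * (1 + r)] with [r] positive, Bernoulli's inequality makes [(1 + r) ^+ n * y] exceed
    [K]. *)
Lemma le_of_exprn_le x y B K : 0 < y -> 0 <= B ->
  (forall n, x ^+ n * y <= K * B ^+ n) -> x <= B.
Proof.
move=> y0 B0 xB; rewrite leNgt; apply/negP => Bx.
have x0 : 0 < x by rewrite (le_lt_trans B0).
have [B_eq0|B_neq0] := eqVneq B 0.
  by have := xB 1%N; rewrite B_eq0 expr0n mulr0 expr1 leNgt mulr_gt0.
have Bgt0 : 0 < B by rewrite lt_neqAle eq_sym B_neq0.
pose r := x / B - 1.
have r0 : 0 < r by rewrite subr_gt0 ltr_pdivlMr // mul1r.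
have xE : x = B * (1 + r) by rewrite /r; field.
pose n := Num.bound (`|K| / y / r).
have nK : `|K| / y / r < n%:R.
  by apply: archi_boundP; rewrite !divr_ge0 // ltW.
have := xB n; rewrite xE exprMn mulrAC [leRHS]mulrC -mulrA.
rewrite ler_pM2l ?exprn_gt0 // => h.
have := exprn_bernoulli r n (ltW r0).
move: nK; rewrite ltr_pdivrMr // ltr_pdivrMr // => nK h2.
have := ler_wpM2r (ltW y0) h2; have := ler_norm K.
lra.
Qed.

(* Multiplying by [p], which vanishes where [f] is singular, makes [f ^+ n * p]
   differentiable everywhere; letting [n] grow removes both the factor [p] and
   the constant 2 of [weak_maximum]. *)
Lemma maximum_principle f p w s B K : 0 < s -> p w != 0 ->
  (forall z, cmod (z - w) <= 2 * s -> derivable p z 1) ->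
  (forall z, cmod (z - w) <= 2 * s -> {for z, continuous f}) ->
  (forall z, cmod (z - w) <= 2 * s -> p z != 0 -> derivable f z 1) ->
  (forall z, s <= cmod (z - w) <= 2 * s -> cmod (f z) <= B) ->
  (forall z, s <= cmod (z - w) <= 2 * s -> cmod (p z) <= K) ->
  cmod (f w) <= B.
Proof.
move=> s0 pw pD fC fD fB pK.
(* A point of the annulus, needed only to see that [B] is nonnegative. *)
have sw : s <= cmod (w + ofR s - w) <= 2 * s.
  by rewrite addrC addKr cmod_ofR ger0_norm ?(ltW s0) // lexx; lra.
have B0 : 0 <= B by rewrite (le_trans (cmod_ge0 _) (fB _ sw)).
apply: (@le_of_exprn_le _ (cmod (p w)) _ (2 * K)) => // [|n].
  by rewrite cmod_gt0.
rewrite -cmodX -cmodM (_ : _ * B ^+ n = 2 * (B ^+ n * K)); last by ring.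
apply: (weak_maximum (fun z => f z ^+ n * p z) w s); first exact: s0.
  move=> z zs; have [pz|pz] := eqVneq (p z) 0.
    exact: (derivable_mul_zero (fun z => f z ^+ n) p z (continuous_exp f z n (fC z zs)) (pD z zs) pz).
  exact: (derivable_mul (fun z => f z ^+ n) p z (derivable_exp f z n (fD z zs pz)) (pD z zs)).
move=> z zs; rewrite cmodM cmodX ler_pM ?exprn_ge0 ?cmod_ge0 ?pK //.
by rewrite lerXn2r ?nnegrE ?cmod_ge0 ?fB.
Qed.

End MaximumPrinciple.

(** * Divided differences *)

Section Removable.
Context {R : realType}.
Implicit Types (z w a u v c l : Cplx R) (f g h D : Cplx R -> Cplx R) (e B M d r x y t : R).

Lemma continuous_local f g z d : 0 < d -> (forall w, cmod (w - z) < d -> f w = g w) ->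
  {for z, continuous f} -> {for z, continuous g}.
Proof.
move=> d0 fg /continuous_cmod fC; apply/continuous_cmod => e /fC[d' d'0 h].
exists (Num.min d d') => [|w]; first by rewrite lt_min d0.
rewrite lt_min => /andP[wd wd']; rewrite -!fg //; first exact: h.
by rewrite subrr cmod0.
Qed.

Lemma derivable_local f g z d : 0 < d -> (forall w, cmod (w - z) < d -> f w = g w) ->
  derivable f z 1 -> derivable g z 1.
Proof.
move=> d0 fg /derivable_diffquo[l fD]; apply/derivable_diffquo; exists l => e /fD[d' d'0 h].
exists (Num.min d d') => [|w]; first by rewrite lt_min d0.
rewrite lt_min => /andP[wd wd'] wz; rewrite -!fg //; first exact: h.
by rewrite subrr cmod0.
Qed.

Lemma quotient_diffquo f a z : z != a ->
  0 < cmod (z - a) /\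
  forall w, cmod (w - z) < cmod (z - a) -> (f w - f a) * (w - a)^-1 = diffquo f a w.
Proof.
move=> za; split=> [|w]; first by rewrite cmod_gt0 subr_eq0.
rewrite /diffquo; case: eqP => [->|//]; by rewrite cmod_distC ltxx.
Qed.

Lemma diffquo_continuous f a z : z != a -> {for z, continuous f} ->
  {for z, continuous (diffquo f a)}.
Proof.
move=> za fz; have [d0 dE] := quotient_diffquo f a z za.
apply: (continuous_local _ _ z _ d0 dE); apply: continuous_mul.
  exact: (continuous_sub f (fun=> f a) z fz (@cst_continuous _ _ _ _)).
apply: (derivable_continuous (fun w => (w - a)^-1)).
by apply: (derivable_inv (fun w => w - a)); [rewrite subr_eq0|exact: derivable_subc].
Qed.

Lemma diffquo_derivable f a z : z != a -> derivable f z 1 -> derivable (diffquo f a) z 1.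
Proof.
move=> za fz; have [d0 dE] := quotient_diffquo f a z za.
apply: (derivable_local _ _ z _ d0 dE); apply: derivable_mul.
  exact: (derivable_sub f (fun=> f a) z fz (derivable_const _ _)).
by apply: (derivable_inv (fun w => w - a)); [rewrite subr_eq0|exact: derivable_subc].
Qed.

(** Compactness by bisection: boundedness on a square follows from boundedness on its quarters and
    holds locally by continuity. The radius [3 / 2 * r] covers the square circumscribed about the
    disc. *)
Lemma bounded_on_disc f r : 0 < r ->
  (forall z, cmod z <= 3 / 2 * r -> {for z, continuous f}) ->
  exists M, forall z, cmod z <= r -> cmod (f z) <= M.
Proof.
move=> r0 fC.
pose P c u := exists M, forall x y, `|x| <= 1 -> `|y| <= 1 ->
  cmod (f (c + (ofR x + ofR y * ci) * u)) <= M.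
suff [M MP] : P 0 (ofR r).
  exists M => z; have [x [y ->]] := complex_split z => zr.
  have := MP (x / r) (y / r); rewrite add0r (_ : _ * ofR r = ofR x + ofR y * ci).
    by rewrite !normrM normfV (gtr0_norm r0) !ler_pdivrMr // !mul1r; apply;
      apply: le_trans zr; [exact: cmod_geRe|exact: cmod_geIm].
  have rn0 : ofR r != 0 by rewrite ofR_eq0 gt_eqF.
  by rewrite !ofRM !ofRV; field.
apply: square_bisection => [c u|z].
  move=> [M1 P1] [M2 P2] [M3 P3] [M4 P4].
  exists (Num.max (Num.max M1 M2) (Num.max M3 M4)) => x y.
  have C t : ofR (2 * t + 1) = 2 * ofR t + 1 /\ ofR (2 * t - 1) = 2 * ofR t - 1 :> Cplx R.
    by rewrite (ofRD (2 * t)) (ofRB (2 * t)) (ofRM 2) ofR_nat ofR1.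
  have [[xp xm] [yp ym]] := (C x, C y).
  rewrite !ler_norml => /andP[x1 x2] /andP[y1 y2]; rewrite !le_max.
  (* The signs of [x] and [y] select the quarter; its own coordinates are [2 * x] and [2 * y]
     shifted by 1 towards 0. *)
  have [x0|x0] := lerP 0 x; have [y0|y0] := lerP 0 y.
  - apply/orP; left; apply/orP; left.
    have := P1 (2 * x - 1) (2 * y - 1); rewrite xm ym (_ : c + _ + _ = c + (ofR x + ofR y * ci) * u).
      by apply; rewrite ler_norml; apply/andP; split; lra.
    by field.
  - apply/orP; left; apply/orP; right.
    have := P2 (2 * x - 1) (2 * y + 1); rewrite xm yp (_ : c + _ + _ = c + (ofR x + ofR y * ci) * u).
      by apply; rewrite ler_norml; apply/andP; split; lra.
    by field.
  - apply/orP; right; apply/orP; right.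
    have := P4 (2 * x + 1) (2 * y - 1); rewrite xp ym (_ : c - _ + _ = c + (ofR x + ofR y * ci) * u).
      by apply; rewrite ler_norml; apply/andP; split; lra.
    by field.
  - apply/orP; right; apply/orP; left.
    have := P3 (2 * x + 1) (2 * y + 1); rewrite xp yp (_ : c - _ + _ = c + (ofR x + ofR y * ci) * u).
      by apply; rewrite ler_norml; apply/andP; split; lra.
    by field.
rewrite subr0 cmod_ofR gtr0_norm // => /fC/continuous_cmod/(_ 1 ltr01)[d d0 dP].
(* Points of the square are within [(2 + 3 / 2) * cmod u] of [z], which is less than [d]. *)
exists (d / 4) => [|c u zc ud]; first by rewrite divr_gt0.
exists (cmod (f z) + 1) => x y x1 y1; set w := c + _.
have wz : cmod (w - z) < d.
  have q2 : cmod (ofR x + ofR y * ci) <= 2 by apply: (le_trans (cmod_le_coord x y)); lra.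
  have := ler_wpM2r (cmod_ge0 u) q2; rewrite -cmodM.
  have := cmodB ((ofR x + ofR y * ci) * u) (z - c).
  rewrite (_ : _ * u - (z - c) = w - z); last by rewrite /w; ring.
  have := cmod_ge0 u; lra.
by have := dP w wz; have := cmodD (f w - f z) (f z); rewrite subrK; lra.
Qed.

(** The limit is found along the sequence [1 / 2 ^+ n]; the Cauchy condition extends it to all
    approaches to 0. *)
Lemma cauchy_limit D :
  (forall e, 0 < e -> exists2 d, 0 < d & forall v w, v != 0 -> w != 0 ->
     cmod v < d -> cmod w < d -> cmod (D v - D w) <= e) ->
  exists l, forall e, 0 < e -> exists2 d, 0 < d & forall v, v != 0 ->
     cmod v < d -> cmod (D v - l) <= e.
Proof.
move=> DC; pose v n : Cplx R := ofR (1 / 2 ^+ n).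
have vE n : cmod (v n) = 1 / 2 ^+ n by rewrite cmod_ofR ger0_norm // divr_ge0.
have v0 n : v n != 0 by rewrite -cmod_gt0 vE divr_gt0 // exprn_gt0.
have [l lP] : exists l, forall e, 0 < e ->
    exists N, forall n, (N <= n)%N -> cmod (D (v n) - l) <= e.
  apply: complex_cauchy => e /DC[d d0 dP]; have [N NP] := div_pow2_small 1 d d0.
  by exists N => m n Nm Nn; apply: dP; rewrite ?v0 ?vE ?NP.
exists l => e e0; have e20 : 0 < e / 2 by rewrite divr_gt0.
have [d d0 dP] := DC _ e20; exists d => // w w0 wd.
have [N1 P1] := lP _ e20; have [N2 P2] := div_pow2_small 1 d d0.
pose n := maxn N1 N2.
have h1 : cmod (D (v n) - l) <= e / 2 by rewrite P1 // leq_maxl.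
have h2 : cmod (D w - D (v n)) <= e / 2 by apply: dP; rewrite ?v0 ?vE ?P2 ?leq_maxr.
have := cmod_triangle (D w) (D (v n)) l; lra.
Qed.

(** As a function of the base point [z], the difference is continuous on the disc and differentiable
    off 0, [v] and [w]. It is estimated directly on an annulus, and the maximum principle carries
    the bound inwards. *)
Lemma diffquo_difference_bound h v w M :
  (forall z, cmod z < 1 -> {for z, continuous h}) ->
  (forall z, cmod z < 1 -> z != 0 -> derivable h z 1) ->
  (forall z, cmod z <= 5 / 8 -> cmod (h z) <= M) ->
  v != 0 -> w != 0 -> cmod v <= 1 / 16 -> cmod w <= 1 / 16 ->
  cmod (diffquo h v 0 - diffquo h w 0) <=
    256 * (2 * M * cmod (v - w) + cmod (h v - h w)).
Proof.
move=> hC hD hM v0 w0 v16 w16; set B := 256 * _.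
pose f z := diffquo h v z - diffquo h w z.
have qC a z : a != 0 -> cmod a <= 1 / 16 -> cmod z < 1 -> {for z, continuous (diffquo h a)}.
  move=> a0 a16 z1; have [->|za] := eqVneq z a.
    by apply: diffquo_cvg; apply: hD => //; lra.
  by apply: diffquo_continuous => //; exact: hC.
have fC z : cmod z < 1 -> {for z, continuous f}.
  move=> z1; exact: (continuous_sub _ _ z (qC v z v0 v16 z1) (qC w z w0 w16 z1)).
have fB z : 1 / 8 <= cmod z <= 5 / 8 -> cmod (f z) <= B.
  move=> /andP[zlo zhi].
  have away a : cmod a <= 1 / 16 -> 1 / 16 <= cmod (z - a) <= 1.
    move=> a16; have := cmodB z a; have := cmodD (z - a) a.
    by rewrite subrK => ? ?; apply/andP; split; lra.
  have /andP[v1 v2] := away v v16; have /andP[w1 w2] := away w w16.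
  have zv : z - v != 0 by rewrite -cmod_gt0; lra.
  have zw : z - w != 0 by rewrite -cmod_gt0; lra.
  (* Over the common denominator the numerator has only terms that are small when [v] and [w] are
     close; the denominator contributes [16 * 16 = 256]. *)
  have -> : f z = ((h z - h v) * (v - w) - (h v - h w) * (z - v)) *
      ((z - v)^-1 * (z - w)^-1).
    rewrite /f /diffquo; move: (zv) (zw); rewrite !subr_eq0 => /negbTE -> /negbTE ->.
    by field; rewrite zv zw.
  have iv a : 1 / 16 <= cmod a -> cmod a^-1 <= 16.
    move=> a16; rewrite cmodV -[leRHS]invrK lef_pV2 ?posrE; lra.
  rewrite cmodM mulrC /B; apply: ler_pM; rewrite ?cmod_ge0 //.
    rewrite cmodM (_ : 256 = 16 * 16); last by ring.
    by apply: ler_pM; rewrite ?cmod_ge0 ?iv.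
  apply: (le_trans (cmodB _ _)); rewrite !cmodM; apply: lerD.
    apply: ler_wpM2r; first exact: cmod_ge0.
    have hz := hM z zhi; have hv : cmod (h v) <= M by apply: hM; lra.
    have := cmodB (h z) (h v); lra.
  by rewrite ler_piMr ?cmod_ge0.
rewrite -/(f 0).
suff main e : 0 < e -> cmod (f 0) <= B + e by apply/ler_addgt0Pr => e /main.
move=> e0; have [|d d0 dP] := (continuous_cmod f 0).1 _ e e0.
  by apply: fC; rewrite cmod0.
(* The maximum principle needs a centre where [p] does not vanish, so it is applied at a point [a]
   near 0 but distinct from 0, [v] and [w]; continuity then reaches 0. *)
pose m := Num.min d (Num.min (cmod v) (cmod w)).
have m0 : 0 < m by rewrite !lt_min d0 !cmod_gt0 v0.
have [md [mv mw]] : m <= d /\ m <= cmod v /\ m <= cmod w.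
  by rewrite /m !ge_min !lexx !orbT.
pose a : Cplx R := ofR (m / 2).
have aE : cmod a = m / 2 by rewrite cmod_ofR ger0_norm // divr_ge0 // ltW.
have an b : m <= cmod b -> a - b != 0.
  by move=> mb; rewrite subr_eq0; apply: contraTneq mb => <-; rewrite aE -ltNge; lra.
pose p z := z * (z - v) * (z - w).
have near z r : cmod (z - a) <= r -> cmod z <= r + 1 / 16.
  by have := cmodD (z - a) a; rewrite subrK aE; lra.
have fa : cmod (f a) <= B.
  (* As [cmod a] is at most [1 / 32], the annulus from [1 / 4] to [1 / 2] around [a] lies in the one
     of [fB]. There the factors of [p] are at most 1, 2 and 2. *)
  apply: (maximum_principle f p a (1 / 4) B 4); first lra.
  - by rewrite /p !mulf_neq0 ?an // -cmod_gt0 aE; lra.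
  - move=> z _; apply: derivable_mul; last exact: derivable_subc.
    by apply: derivable_mul; [exact: derivable_id|exact: derivable_subc].
  - by move=> z /near z1; apply: fC; lra.
  - move=> z /near z1; rewrite /p !mulf_eq0 !negb_or !subr_eq0 => /andP[/andP[z0 zv] zw].
    have hz : derivable h z 1 by apply: hD => //; lra.
    exact: (derivable_sub _ _ z (diffquo_derivable h v z zv hz) (diffquo_derivable h w z zw hz)).
  - move=> z /andP[z1 z2]; apply: fB; have := near _ _ z2; have := cmodB z a.
    by rewrite aE => ? ?; apply/andP; split; lra.
  - move=> z /andP[z1 z2]; have := near _ _ z2 => z3; rewrite /p !cmodM.
    have zv : cmod (z - v) <= 2 by have := cmodB z v; lra.
    have zw : cmod (z - w) <= 2 by have := cmodB z w; lra.
    rewrite (_ : 4 = 1 * 2 * 2); last by ring.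
    by rewrite !ler_pM ?mulr_ge0 ?cmod_ge0 //; lra.
have := dP a; rewrite subr0 aE => /(_ _).
have := cmodB (f a) (f a - f 0); rewrite opprB addrCA subrr addr0 => h1 h2.
by have := h2 ltac:(lra); lra.
Qed.

End Removable.

(** * The spectrum *)

Section Spectrum.
Context {R : realType}.
Implicit Types (z w a beta lam mu : Cplx R) (f g h m : Cplx R -> Cplx R).

Lemma norm_lt1 z : (`|z| < 1) = (cmod z < 1).
Proof. by rewrite norm_cmod -ofR1 ofR_lt. Qed.

(* The removable singularity theorem for [(g z - g 0) / z]; equivalently, [g] is
   twice differentiable at 0. *)
Lemma holo_diffquo g : holo_disc g -> holo_disc (diffquo g 0).
Proof.
move=> gH; set h := diffquo g 0.
have gD z : cmod z < 1 -> derivable g z 1 by rewrite -norm_lt1; exact: gH.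
have hD z : cmod z < 1 -> z != 0 -> derivable h z 1.
  by move=> z1 z0; apply: diffquo_derivable => //; exact: gD.
have hC z : cmod z < 1 -> {for z, continuous h}.
  move=> z1; have [->|z0] := eqVneq z 0; last exact: derivable_continuous h z (hD z z1 z0).
  by apply: diffquo_cvg; apply: gD; rewrite cmod0.
move=> z; rewrite norm_lt1 => z1; have [{z z1}->|] := eqVneq z 0; last exact: hD.
have [M M1 hM] : exists2 M, 1 <= M & forall z, cmod z <= 5 / 8 -> cmod (h z) <= M.
  have [||M hM] := bounded_on_disc h (5 / 8); first by rewrite divr_gt0.
    by move=> z z1; apply: hC; lra.
  by exists (Num.max M 1) => [|z /hM Mz]; rewrite le_max ?lexx ?orbT ?Mz.
have M0 : 0 < M by rewrite (lt_le_trans ltr01).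
pose D v := diffquo h v 0.
have [e e0|l lP] := cauchy_limit D.
  (* Both [M * cmod (v - w)] and the variation of [h] from its value at 0 are kept below [q], and
     [256 * (2 * q + 2 * q) = e]. *)
  have [q q0 qE] : exists2 q, 0 < q & q = e / 1024 by exists (e / 1024); lra.
  have [k k0 kE] : exists2 k, 0 < k & k * M = q.
    by exists (q / M); [rewrite divr_gt0|rewrite divfK // gt_eqF].
  have [|d d0 dP] := (continuous_cmod h 0).1 _ q q0; first by apply: hC; rewrite cmod0.
  exists (Num.min (1 / 16) (Num.min d (k / 2))) => [|v w v0 w0].
    by rewrite !lt_min d0 !divr_gt0.
  rewrite !lt_min => /andP[v16 /andP[vd vk]] /andP[w16 /andP[wd wk]].
  apply: (le_trans (diffquo_difference_bound h v w M hC hD hM v0 w0 (ltW v16) (ltW w16))).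
  have hvw : cmod (h v - h w) <= 2 * q.
    have := dP v; have := dP w; rewrite !subr0 => /(_ wd) hw /(_ vd) hv.
    by have := cmod_triangle (h v) (h 0) (h w); rewrite (cmod_distC (h 0)); lra.
  have vw : cmod (v - w) <= k by have := cmodB v w; lra.
  have : M * cmod (v - w) <= q by rewrite -kE mulrC ler_wpM2r // ltW.
  lra.
apply/derivable_diffquo; exists l => e /lP[d d0 dP]; exists d => // v.
rewrite subr0 => vd v0; have := dP v v0 vd.
rewrite /D {1}/diffquo eq_sym (negbTE v0) sub0r invrN mulrN -mulNr opprB.
by [].
Qed.

(** The factorization holds on the whole plane, so that [g] can be replaced by function
    extensionality. *)
Lemma holo_factor g : holo_disc g -> g 0 = 0 ->
  exists2 h, holo_disc h & forall z, g z = z * h z.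
Proof.
move=> gH g0; exists (diffquo g 0); first exact: holo_diffquo.
move=> z; have [->|z0] := eqVneq z 0; first by rewrite mul0r.
by rewrite /diffquo (negbTE z0) g0 !subr0 mulrC divfK.
Qed.

Lemma holo_idM h : holo_disc h -> holo_disc (fun z => z * h z).
Proof.
move=> hH z /hH hz; apply: (derivable_mul (fun w => w) h z _ hz).
exact: derivable_id.
Qed.

Lemma holo_cst a : holo_disc (fun=> a).
Proof. by move=> z _; exact: derivable_const. Qed.

Lemma holo_mul f g : holo_disc f -> holo_disc g -> holo_disc (fun z => f z * g z).
Proof. by move=> fH gH z z1; exact: (derivable_mul f g z (fH z z1) (gH z z1)). Qed.

Lemma holo_sub f g : holo_disc f -> holo_disc g -> holo_disc (fun z => f z - g z).
Proof. by move=> fH gH z z1; exact: (derivable_sub f g z (fH z z1) (gH z z1)). Qed.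

Lemma holo_rotation beta f : `|beta| = 1 -> holo_disc f -> holo_disc (fun z => f (beta * z)).
Proof.
move=> b1 fH z z1.
have fz : differentiable f (beta * z).
  by apply/derivable1_diffP; apply: fH; rewrite normrM b1 mul1r.
have bz : differentiable (fun w : Cplx R => beta * w) z.
  apply/derivable1_diffP.
  apply: (derivable_mul (fun=> beta) (fun w => w) z (derivable_const _ _)).
  exact: derivable_id.
apply/derivable1_diffP; exact: (differentiable_comp bz fz).
Qed.

Lemma holo_shifted_op m beta lam f : `|beta| = 1 -> holo_disc m -> holo_disc f ->
  holo_disc (shifted_op m beta lam f).
Proof.
move=> b1 mH fH; apply: (holo_sub (fun z => lam * f z) (fun z => m z * f (beta * z))).
  exact: (holo_mul (fun=> lam) f (holo_cst lam) fH).
exact: (holo_mul m (fun z => f (beta * z)) mH (holo_rotation beta f b1 fH)).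
Qed.

(** Continuity at 0 recovers the value that is lost when an equation is divided by [z]. *)
Lemma holo_eq_punctured f g : holo_disc f -> holo_disc g ->
  (forall z, `|z| < 1 -> z != 0 -> f z = g z) -> forall z, `|z| < 1 -> f z = g z.
Proof.
move=> fH gH fg z z1; have [->|z0] := eqVneq z 0; last exact: fg.
apply/eqP; rewrite -subr_eq0 -cmod_eq0 -[_ == 0]negbK; apply/negP => k0.
have {}k0 : 0 < cmod (f 0 - g 0) by rewrite lt_neqAle eq_sym k0 cmod_ge0.
set k := cmod _ in k0.
have n01 : `|0 : Cplx R| < 1 by rewrite normr0.
have : {for 0, continuous (fun w => f w - g w)}.
  exact: (derivable_continuous (fun w => f w - g w) 0 (holo_sub f g fH gH 0 n01)).
have k20 : 0 < k / 2 by rewrite divr_gt0.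
move=> /continuous_cmod/(_ _ k20)[d d0 dP].
pose e := Num.min (d / 2) (1 / 2).
have e0 : 0 < e by rewrite lt_min !divr_gt0.
have [ed e1] : e <= d / 2 /\ e <= 1 / 2 by rewrite /e !ge_min !lexx orbT.
have ae : cmod (ofR e) = e by rewrite cmod_ofR gtr0_norm.
have := dP (ofR e); rewrite subr0 ae fg; [|by rewrite norm_lt1 ae; lra|].
  by rewrite subrr sub0r cmodN -/k => /(_ ltac:(lra)); lra.
by rewrite ofR_eq0 gt_eqF.
Qed.

(** * The operators on functions vanishing at 0 *)

Lemma shifted_opB m beta lam f g z :
  shifted_op m beta lam (fun z => f z - g z) z =
  shifted_op m beta lam f z - shifted_op m beta lam g z.
Proof. by rewrite /shifted_op /wcomp; ring. Qed.

Lemma shifted_op_idM m beta lam h z :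
  shifted_op m beta (beta * lam) (fun z => z * h z) z =
  beta * z * shifted_op m beta lam h z.
Proof. by rewrite /shifted_op /wcomp; ring. Qed.

Lemma shifted_op_at0 m beta lam f : shifted_op m beta lam f 0 = (lam - m 0) * f 0.
Proof. by rewrite /shifted_op /wcomp mulr0; ring. Qed.

Section Rotation.
Context (m : Cplx R -> Cplx R) (beta lam : Cplx R).
Context (beta1 : `|beta| = 1) (mH : holo_disc m) (lam_m0 : beta * lam != m 0).

Let beta0 : beta != 0.
Proof. by rewrite -normr_eq0 beta1 oner_eq0. Qed.

Let gap : beta * lam - m 0 != 0.
Proof. by rewrite subr_eq0. Qed.

(** A kernel element vanishes at 0 because [beta * lam - m 0] is nonzero, hence is [z * h] with [h]
    in the kernel for [lam]. For surjectivity, a constant first matches the value at 0. *)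
Lemma bijective_rotate :
  bijective_on_Hol (shifted_op m beta lam) ->
  bijective_on_Hol (shifted_op m beta (beta * lam)).
Proof.
move=> [inj surj]; split=> [f g fH gH fg z z1|g gH].
  have dH := holo_sub f g fH gH.
  have d0 z' : `|z'| < 1 -> shifted_op m beta (beta * lam) (fun z => f z - g z) z' = 0.
    by move=> z'1; rewrite shifted_opB fg // subrr.
  have [|h hH hE] := holo_factor _ dH.
    have := d0 0; rewrite normr0 shifted_op_at0 => /(_ ltr01) /eqP.
    by rewrite mulf_eq0 (negbTE gap) => /eqP.
  have h0 z' : `|z'| < 1 -> h z' = 0.
    move=> z'1; apply: (inj h (fun=> 0) hH (holo_cst 0) _ z' z'1) => w w1.
    have sH := holo_shifted_op m beta lam h beta1 mH hH.
    transitivity (0 : Cplx R); last by rewrite /shifted_op /wcomp; ring.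
    apply: (holo_eq_punctured _ (fun=> 0) sH (holo_cst 0) _ w w1) => {w1}w w1 w0.
    have := d0 w w1; rewrite (_ : (fun z => f z - g z) = (fun z => z * h z)); last exact/funext.
    by rewrite shifted_op_idM => /eqP; rewrite !mulf_eq0 (negbTE beta0) (negbTE w0) => /eqP.
  by apply/eqP; rewrite -subr_eq0 hE h0 // mulr0.
pose a := g 0 / (beta * lam - m 0).
have cH := holo_shifted_op m beta (beta * lam) _ beta1 mH (holo_cst a).
have [|h hH hE] := holo_factor _ (holo_sub _ _ gH cH).
  by rewrite shifted_op_at0 /a mulrC divfK // subrr.
(* The factor [beta^-1] offsets the [beta] of [shifted_op_idM], so [z * e z] is mapped to
   [z * h z]. *)
have [e [eH eE]] := surj _ (holo_mul _ _ (holo_cst beta^-1) hH).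
exists (fun z => z * e z - - a); split.
  exact: (holo_sub _ _ (holo_idM e eH) (holo_cst (- a))).
move=> z z1; rewrite shifted_opB shifted_op_idM eE //.
have := hE z; rewrite /shifted_op /wcomp => /eqP; rewrite subr_eq => /eqP ->.
by field.
Qed.

(** Multiplication by [z] transports injectivity. A preimage of [beta * (z * g z)] must vanish at 0,
    and dividing it by [z] gives a preimage of [g]. *)
Lemma bijective_unrotate :
  bijective_on_Hol (shifted_op m beta (beta * lam)) ->
  bijective_on_Hol (shifted_op m beta lam).
Proof.
move=> [inj surj]; split=> [f g fH gH fg|g gH].
  apply: (holo_eq_punctured f g fH gH) => z z1 z0; apply: (mulfI z0).
  apply: (inj _ _ (holo_idM f fH) (holo_idM g gH) _ z z1) => w w1.
  by rewrite !shifted_op_idM fg.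
have [f [fH fE]] := surj _ (holo_mul _ _ (holo_cst beta) (holo_idM g gH)).
have [|h hH hE] := holo_factor f fH.
  have := fE 0; rewrite normr0 shifted_op_at0 mul0r mulr0 => /(_ ltr01) /eqP.
  by rewrite mulf_eq0 (negbTE gap) => /eqP.
exists h; split=> //.
apply: (holo_eq_punctured _ _ (holo_shifted_op m beta lam h beta1 mH hH) gH) => z z1 z0.
have := fE z z1; rewrite (_ : f = (fun z => z * h z)); last exact/funext.
by rewrite shifted_op_idM mulrA => /mulfI; apply; rewrite mulf_neq0.
Qed.

End Rotation.

(** Every function in the range vanishes at 0, so the constant 1 is not attained. *)
Lemma spectrum_m0 m beta : spectrum_wcomp m beta (m 0).
Proof.
move=> [_ /(_ (fun=> 1) (holo_cst 1)) [f [_ /(_ 0)]]].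
rewrite normr0 shifted_op_at0 subrr mul0r => /(_ ltr01)/esym/eqP.
by rewrite oner_eq0.
Qed.

End Spectrum.

Theorem theorem2p1 (R : realType) (beta : Cplx R) (m : Cplx R -> Cplx R) :
  `|beta| = 1 ->
  holo_disc m ->
  (exists z : Cplx R, `|z| < 1 /\ m z != 0) ->
  spectrum_wcomp m beta =
    [set beta * lam | lam in spectrum_wcomp m beta] `|` [set m 0].
Proof.
move=> beta1 mH _; have beta0 : beta != 0 by rewrite -normr_eq0 beta1 oner_eq0.
apply/seteqP; split=> [mu muS|_ [[lam lamS <-]|->]]; last exact: spectrum_m0.
  have [->|mu_m0] := eqVneq mu (m 0); [by right|left].
  (* Were [mu / beta] outside the spectrum, [bijective_rotate] would put [mu] outside it as well. *)
  have muE : beta * (mu / beta) = mu by rewrite mulrC divfK.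
  exists (mu / beta) => // bij; apply: muS; rewrite -muE.
  by apply: bijective_rotate => //; rewrite muE.
have [->|lam_m0] := eqVneq (beta * lam) (m 0); first exact: spectrum_m0.
by move=> bij; apply: lamS; exact: bijective_unrotate bij.
Qed.
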